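(* Let $r_L,r_R\ge 1$ be integers and let $\lambda_{-r_L},\dots,\lambda_{r_R}\in\mathbb{Z}_2$ with $\lambda_{-r_L}=\lambda_{r_R}=1$. Let $\tau:\mathbb{Z}_2^{r_L+r_R}\to\mathbb{Z}_2^{r_L+r_R}$ be $\tau(a_0,\dots,a_{r_L+r_R-1})=(a_1,\dots,a_{r_L+r_R-1},b)$ with $b=\sum_{k=0}^{r_L+r_R-1}\lambda_{k-r_L}a_k \bmod 2$. For $0\le i<2^{r_R}$ with binary expansion $i=\sum_{j=0}^{r_R-1}e_{j+1}2^j$, let $\mathrm{tuple}^{(1)}_i=(0,\dots,0,e_1,\dots,e_{r_R})$ ($r_L$ zeros followed by $e_1,\dots,e_{r_R}$) and $\mathrm{tuple}^{(k+1)}_i=\tau(\mathrm{tuple}^{(k)}_i)$. Fix $k\ge1$ and let $\mathrm{Trans}_1,\dots,\mathrm{Trans}_{r_R}\in\mathbb{Z}_2^{r_R}$ be the postfixes (last $r_R$ entries) of $\mathrm{tuple}^{(k)}_{2^0},\mathrm{tuple}^{(k)}_{2^1},\dots,\mathrm{tuple}^{(k)}_{2^{r_R-1}}$, i.e. the postfixes in node $k$ obtained from the standard basis postfixes of the initial node. If $\mathrm{Trans}_1,\dots,\mathrm{Trans}_{r_R}$ are linearly independent over $\mathbb{Z}_2$, then node $k$ is reversible; otherwise node $k$ is irreversible.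
   Context: The $k$-th node of the DFA is the list of $2^{r_R}$ tuples $(\mathrm{tuple}^{(k)}_i)_{0\le i<2^{r_R}}$; this DFA is associated with the one-dimensional linear cellular automaton over $\mathbb{Z}_2$ under null boundary with local rule $s_i^{t+1}=\sum_{l=-r_L}^{r_R}\lambda_l s^t_{i+l}\bmod 2$. A node is called reversible if the postfixes of its $2^{r_R}$ tuples are pairwise distinct, and irreversible if two or more of its tuples have the same postfix. *)

(* Defs.v *)
From HB Require Import structures.
From mathcomp Require Import all_boot all_order all_algebra.

Set Implicit Arguments.
Unset Strict Implicit.
Unset Printing Implicit Defensive.
Import GRing.Theory.
Local Open Scope ring_scope.

(* The coefficients of the local rule s_i <- \sum_(-rL <= l <= rR) lam l * s_(i+l)
   are given as a function on int; only its values on [-rL, rR] are relevant. *)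

(* The shift (a_0, ..., a_(n-1)) |-> (a_1, ..., a_(n-1), b), with n = rL + rR:
   insub j.+1 is None exactly when j is the last position. *)
Definition tau (rL rR : nat) (lam : int -> 'F_2) (a : 'rV['F_2]_(rL + rR)) :
    'rV['F_2]_(rL + rR) :=
  let b := \sum_(k < rL + rR) lam (k%:Z - rL%:Z) * a 0 k in
  \row_(j < rL + rR)
    if (insub j.+1 : option 'I_(rL + rR)) is Some j' then a 0 j' else b.

(* The coefficient of 2 ^ j in the binary expansion of i, i.e. e_(j+1). *)
Definition bin_digit (i j : nat) : 'F_2 := (odd (i %/ 2 ^ j)%N)%:R.

Definition init_tuple (rL rR i : nat) : 'rV['F_2]_(rL + rR) :=
  row_mx 0 (\row_(j < rR) bin_digit i j).

(* Nodes are numbered from 1; the value at k = 0 is junk. *)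
Definition dfa_tuple (rL rR : nat) (lam : int -> 'F_2) (k i : nat) :
    'rV['F_2]_(rL + rR) :=
  iter k.-1 (tau lam) (init_tuple rL rR i).

Definition node (rL rR : nat) (lam : int -> 'F_2) (k : nat) :
    'I_(2 ^ rR) -> 'rV['F_2]_(rL + rR) :=
  fun i => dfa_tuple rL rR lam k i.

Arguments node rL rR lam k i : clear implicits.

Definition postfix (rL rR : nat) (a : 'rV['F_2]_(rL + rR)) : 'rV['F_2]_rR :=
  rsubmx a.

Definition reversible (rL rR : nat)
    (N : 'I_(2 ^ rR) -> 'rV['F_2]_(rL + rR)) : Prop :=
  forall i j, i != j -> postfix (N i) <> postfix (N j).

Definition irreversible (rL rR : nat)
    (N : 'I_(2 ^ rR) -> 'rV['F_2]_(rL + rR)) : Prop :=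
  exists i j, i != j /\ postfix (N i) = postfix (N j).

(* The 0-based entry j is Trans_(j+1). *)
Definition Trans (rL rR : nat) (lam : int -> 'F_2) (k : nat) :
    rR.-tuple 'rV['F_2]_rR :=
  [tuple postfix (dfa_tuple rL rR lam k (2 ^ j)) | j < rR].

(* Main.v *)
Require Import Defs.
From HB Require Import structures.
From mathcomp Require Import all_boot all_order all_algebra.
Import GRing.Theory.
Local Open Scope ring_scope.

(* tau is linear over Z_2 and the postfix of the i-th initial tuple is the
   vector of binary digits of i, so the postfix of the i-th tuple of node k is
   the linear combination of the Trans_j with these digits as coefficients.
   Binary expansion is a bijection from {0, ..., 2 ^ rR - 1} onto Z_2 ^ rR,
   hence the node is reversible iff this linear map is injective, i.e. iff the
   Trans_j are linearly independent. *)

Lemma tau_is_linear (rL rR : nat) (lam : int -> 'F_2) :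
  linear (@tau rL rR lam).
Proof.
move=> c u v; apply/rowP => j; rewrite !mxE.
case: insub => [j'|]; first by rewrite !mxE.
rewrite mulr_sumr -big_split /=; apply: eq_bigr => l _.
by rewrite !mxE mulrDr mulrCA.
Qed.

HB.instance Definition _ (rL rR : nat) (lam : int -> 'F_2) :=
  GRing.isLinear.Build _ _ _ _ (@tau rL rR lam) (tau_is_linear rL rR lam).

Lemma iter_linear_sum (R : pzRingType) (V : lmodType R) (f : {linear V -> V})
    (I : finType) (c : I -> R) (x : I -> V) (n : nat) :
  iter n f (\sum_i c i *: x i) = \sum_i c i *: iter n f (x i).
Proof.
elim: n => [//|n IHn] /=; rewrite IHn linear_sum.
by apply: eq_bigr => i _; rewrite linearZ.
Qed.

Lemma bin_digit_exp2 (m j : nat) : bin_digit (2 ^ m) j = (j == m)%:R.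
Proof.
rewrite /bin_digit; case: (ltngtP j m) => [lt_jm|lt_mj|->].
- rewrite -(subnK (ltnW lt_jm)) expnD mulnK ?expn_gt0 //.
  by rewrite oddX subn_eq0 leqNgt lt_jm.
- by rewrite divn_small // ltn_exp2l.
- by rewrite divnn expn_gt0.
Qed.

(** Induction on [n]: digit [m] of [i %/ 2] is digit [m.+1] of [i], so the halves agree, and digit
    [0] fixes the parity. *)
Lemma bin_digit_inj (n i j : nat) : (i < 2 ^ n)%N -> (j < 2 ^ n)%N ->
  (forall m, (m < n)%N -> bin_digit i m = bin_digit j m) -> i = j.
Proof.
elim: n i j => [|n IHn] i j; first by case: i j => [|i] [|j].
rewrite expnSr -!ltn_divLR // => lt_i lt_j eq_ij.
have eq_half : (i %/ 2 = j %/ 2)%N.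
  apply: IHn => // m lt_mn.
  by have := eq_ij m.+1 lt_mn; rewrite /bin_digit expnS !divnMA.
have := eq_ij 0 isT; rewrite /bin_digit !divn1 => eq_odd.
rewrite (divn_eq i 2) (divn_eq j 2) eq_half !modn2.
by case: (odd i) (odd j) eq_odd => [] [].
Qed.

(** An injection between finite sets of the same cardinality [2 ^ n] is onto. *)
Lemma bin_digit_onto (n : nat) (c : 'I_n -> 'F_2) :
  exists i : 'I_(2 ^ n), forall j : 'I_n, bin_digit i j = c j.
Proof.
pose f (i : 'I_(2 ^ n)) := \row_(j < n) bin_digit i j.
have f_inj : injective f.
  move=> i i' /rowP eq_f.
  apply/val_inj/(bin_digit_inj n _ _ (ltn_ord _) (ltn_ord _)) => m lt_mn.
  by have := eq_f (Ordinal lt_mn); rewrite !mxE.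
have /codomP[i /rowP eq_c] : \row_j c j \in codom f.
  by apply: inj_card_onto; rewrite // card_mx !card_ord mul1n.
by exists i => j; have := eq_c j; rewrite !mxE.
Qed.

Lemma init_tuple_sum (rL rR i : nat) :
  init_tuple rL rR i
  = \sum_(j < rR) bin_digit i j *: init_tuple rL rR (2 ^ j).
Proof.
apply/rowP => m; rewrite summxE /init_tuple -(splitK m).
case: (split m) => l /=.
  by rewrite row_mxEl mxE big1 // => j _; rewrite mxE row_mxEl mxE mulr0.
(* In the last [rR] positions, [2 ^ j] contributes the [j]-th unit vector, so only the term [j = l]
   survives at entry [l]. *)
rewrite row_mxEr mxE (bigD1 l) //= big1 => [|j ne_jl].
  by rewrite mxE row_mxEr mxE bin_digit_exp2 eqxx mulr1 addr0.
rewrite mxE row_mxEr mxE bin_digit_exp2.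
by rewrite (inj_eq val_inj) eq_sym (negPf ne_jl) mulr0.
Qed.

Lemma postfix_dfa_tuple (rL rR : nat) (lam : int -> 'F_2) (k i : nat) :
  postfix (dfa_tuple rL rR lam k i)
  = \sum_(j < rR) bin_digit i j *: (Trans rL rR lam k)`_j.
Proof.
rewrite /dfa_tuple init_tuple_sum iter_linear_sum /postfix linear_sum.
by apply: eq_bigr => j _; rewrite linearZ -tnth_nth tnth_mktuple.
Qed.

(** If two postfixes agree, the digit differences are the coefficients of a vanishing combination of
    the [Trans] vectors, hence all zero. *)
Lemma free_Trans_reversible (rL rR : nat) (lam : int -> 'F_2) (k : nat) :
  free (Trans rL rR lam k) -> reversible (node rL rR lam k).
Proof.
move=> /freeP indep i j ne_ij; rewrite /node !postfix_dfa_tuple => eq_ij.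
case/eqP: ne_ij.
apply/val_inj/(bin_digit_inj rR _ _ (ltn_ord _) (ltn_ord _)) => m lt_mR.
apply/eqP; rewrite -subr_eq0; apply/eqP.
apply: (indep (fun l => bin_digit i l - bin_digit j l) _ (Ordinal lt_mR)).
under eq_bigr do rewrite scalerBl.
by rewrite sumrB eq_ij subrr.
Qed.

Lemma reversible_free_Trans (rL rR : nat) (lam : int -> 'F_2) (k : nat) :
  reversible (node rL rR lam k) -> free (Trans rL rR lam k).
Proof.
move=> rev; apply/freeP => c sum0 l.
(* A vanishing combination is read as an index [i] with digits [c]; [z] is the index with zero
   digits. Both have postfix [0], so reversibility forces [i = z], that is [c = 0]. *)
have [i digits_i] := bin_digit_onto rR c.
have [z digits_z] := bin_digit_onto rR (fun=> 0).
have [eq_iz | /rev[]] := eqVneq i z; first by rewrite -digits_i eq_iz digits_z.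
rewrite /node !postfix_dfa_tuple.
under eq_bigr do rewrite digits_i.
under [RHS]eq_bigr do rewrite digits_z scale0r.
by rewrite sum0 big1.
Qed.

Theorem theorem8 (rL rR : nat) (lam : int -> 'F_2) (k : nat)
    (hrL : (1 <= rL)%N) (hrR : (1 <= rR)%N)
    (hlamL : lam (- rL%:Z) = 1) (hlamR : lam rR%:Z = 1)
    (hk : (1 <= k)%N) :
  (free (Trans rL rR lam k) -> reversible (node rL rR lam k)) /\
  (~~ free (Trans rL rR lam k) -> irreversible (node rL rR lam k)).
Proof.
split; first exact: free_Trans_reversible.
move=> nfree; pose N := node rL rR lam k.
(* A collision among finitely many indices is decidable, so a witness pair is obtained without
   classical axioms. *)
have [/existsP[i /existsP[j /andP[ne_ij /eqP eq_ij]]] | no_coll] :=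
  boolP [exists i, exists j, (i != j) && (postfix (N i) == postfix (N j))].
  by exists i, j.
case/negP: nfree; apply: reversible_free_Trans => i j ne_ij eq_ij.
case/negP: no_coll; apply/existsP; exists i; apply/existsP; exists j.
by rewrite ne_ij /N eq_ij eqxx.
Qed.
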